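(* Let $\mathbb{K}$ be a fixed field. If $X$ is a simplicial complex with $\Delta_{n-1}^{(k-1)} \subset X \subset \Delta_{n-1}$ and $0 \le \ell < k$, then $$\tilde{\beta}_{k-1}(X) \le \frac{1}{\binom{k+1}{\ell+1}}\,\lambda_{\ell,k-\ell-2}(X) + B_{n,k,\ell},$$ where $$\lambda_{\ell,k-\ell-2}(X)=\sum_{\tau \in X(\ell)} \tilde{\beta}_{k-\ell-2}(\mathrm{lk}(X,\tau)), \qquad B_{n,k,\ell}=\frac{\binom{n-1}{\ell}\binom{n-\ell-2}{k-\ell}}{\binom{k+1}{\ell+1}}.$$
   Context: $\Delta_{n-1}$ is the $(n-1)$-simplex on the vertex set $[n]=\{0,\ldots,n-1\}$, and $Y^{(j)}$ denotes the $j$-dimensional skeleton of a simplicial complex $Y$. $X(j)$ is the family of $j$-dimensional simplices of $X$. For $\tau\in X$, the link is $\mathrm{lk}(X,\tau)=\{\sigma\in X: \sigma\cup\tau\in X,\ \sigma\cap\tau=\emptyset\}$. $\tilde{\beta}_j(Y)=\dim_{\mathbb{K}}\tilde{H}_j(Y;\mathbb{K})$ is the $j$-th reduced Betti number of $Y$ over $\mathbb{K}$ (complexes contain the empty simplex, of dimension $-1$, so that $\tilde\beta_{-1}(\{\emptyset\})=1$ and $\tilde\beta_{-1}(Y)=0$ if $Y$ has a vertex). The symbol $\subset$ allows equality. *)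

(* Defs.v *)
From HB Require Import structures.
From mathcomp Require Import all_boot all_order all_algebra.
Set Implicit Arguments.
Unset Strict Implicit.
Unset Printing Implicit Defensive.
Import Order.TTheory GRing.Theory Num.Theory.
Local Open Scope ring_scope.

(* A family of simplices on the vertex set [n] = {0, ..., n-1} is a set of    *)
(* sets of vertices; a complex on [n] need not use all of [n] as vertices.    *)
Notation family n := {set {set 'I_n}}.

(* Complexes contain the empty simplex. *)
Definition simplicial_complex n (X : family n) : Prop :=
  set0 \in X /\
  (forall s t : {set 'I_n}, s \in X -> t \subset s -> t \in X).

(* Dimensions are integers, as the empty simplex has dimension -1. *)
Definition simplex_dim n (s : {set 'I_n}) : int := #|s|%:Z - 1.

Definition full_simplex n : family n := [set: {set 'I_n}].

Definition skeleton n (X : family n) (j : int) : family n :=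
  [set s in X | simplex_dim s <= j].

Definition faces n (X : family n) (j : int) : family n :=
  [set s in X | simplex_dim s == j].

Definition link n (X : family n) (t : {set 'I_n}) : family n :=
  [set s in X | (s :|: t \in X) && (s :&: t == set0)].

Section Homology.
Variables (K : fieldType) (n : nat).
Implicit Types (X : family n) (s : {set 'I_n}) (v : 'I_n) (j : int).

(* Formal K-linear combinations of subsets of [n], in all dimensions at once; *)
(* each subset is oriented by the natural order of its vertices.              *)
Definition chain := {ffun {set 'I_n} -> K^o}.

Definition basis_chain s : chain := [ffun t => (t == s)%:R].

Definition boundary_simplex s : chain :=
  \sum_(v in s) (-1) ^+ #|[set u in s | (u < v)%N]| *: basis_chain (s :\ v).

(* Vertices have boundary the empty simplex: this is the augmented complex.   *)
Definition boundary_fun (c : chain) : chain :=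
  \sum_s c s *: boundary_simplex s.

Fact boundary_fun_is_linear : linear boundary_fun.
Proof.
move=> a c d; rewrite /boundary_fun scaler_sumr -big_split /=.
by apply: eq_bigr => s _; rewrite !ffunE scalerDl scalerA.
Qed.
HB.instance Definition _ :=
  GRing.isLinear.Build K chain chain *:%R boundary_fun boundary_fun_is_linear.

Definition boundary : 'End(chain) := linfun boundary_fun.

Definition chains X j : {vspace chain} :=
  <<[seq basis_chain s | s in faces X j]>>%VS.

Definition cycles X j : {vspace chain} := (chains X j :&: lker boundary)%VS.

Definition boundaries X j : {vspace chain} :=
  (boundary @: chains X (j + 1))%VS.

(* The subtraction does not truncate: see boundaries_sub_cycles below. *)
Definition rbetti X j : nat := (\dim (cycles X j) - \dim (boundaries X j))%N.

Lemma boundary_basis s : boundary (basis_chain s) = boundary_simplex s.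
Proof.
rewrite lfunE /= /boundary_fun (bigD1 s) //= ffunE eqxx scale1r.
by rewrite big1 ?addr0 // => t /negbTE ts; rewrite ffunE ts scale0r.
Qed.

Lemma boundary_sign_swap s u v : u \in s -> v \in s -> (u < v)%N ->
  (-1) ^+ #|[set w in s | (w < u)%N]| *
    (-1) ^+ #|[set w in s :\ u | (w < v)%N]| =
  - ((-1) ^+ #|[set w in s | (w < v)%N]| *
     (-1) ^+ #|[set w in s :\ v | (w < u)%N]|) :> K.
Proof.
move=> us vs uv.
have -> : [set w in s :\ v | (w < u)%N] = [set w in s | (w < u)%N].
  apply/setP=> w; rewrite !inE; case: (w =P v) => //= ->.
  by rewrite ltnNge (ltnW uv) andbF.
have -> : [set w in s | (w < v)%N] = u |: [set w in s :\ u | (w < v)%N].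
  by apply/setP=> w; rewrite !inE; case: (w =P u) => //= ->; rewrite us uv.
by rewrite cardsU1 !inE eqxx /= exprS mulN1r mulNr opprK mulrC.
Qed.

Lemma boundary_boundary c : boundary (boundary c) = 0.
Proof.
rewrite (lfunE boundary_fun c) /= /boundary_fun linear_sum /=.
apply: big1 => s _; rewrite linearZ /=.
suff -> : boundary (boundary_simplex s) = 0 by rewrite scaler0.
rewrite /boundary_simplex linear_sum /=.
pose F (v u : 'I_n) : chain :=
  ((-1) ^+ #|[set w in s | (w < v)%N]| *
   (-1) ^+ #|[set w in s :\ v | (w < u)%N]|) *: basis_chain (s :\ v :\ u).
have -> : \sum_(v in s) boundary
    ((-1) ^+ #|[set w in s | (w < v)%N]| *: basis_chain (s :\ v)) =
    \sum_(v in s) \sum_(u in s | u != v) F v u.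
  apply: eq_bigr => v _; rewrite linearZ /= boundary_basis scaler_sumr.
  by apply: eq_big => [u|u _]; rewrite ?in_setD1 ?scalerA // andbC.
have -> : \sum_(v in s) \sum_(u in s | u != v) F v u =
    \sum_(v in s) \sum_(u in s | (u < v)%N) F v u +
    \sum_(v in s) \sum_(u in s | (v < u)%N) F v u.
  rewrite -big_split /=; apply: eq_bigr => v _.
  rewrite (bigID (fun u : 'I_n => (u < v)%N)) /=; congr (_ + _).
    by apply: eq_bigl => u; rewrite -val_eqE /= -andbA; case: ltngtP.
  by apply: eq_bigl => u; rewrite -val_eqE /= -andbA; case: ltngtP.
rewrite [X in _ + X](exchange_big_dep (mem s)) /=; last by move=> v u _ /andP[].
rewrite -big_split big1 //= => v vs.
rewrite [X in _ + X](eq_bigl (fun u : 'I_n => (u \in s) && (u < v)%N)); last first.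
  by move=> u; rewrite vs.
rewrite -big_split big1 //= => u /andP[us uv].
by rewrite /F (boundary_sign_swap us vs uv) scaleNr !setDDl setUC subrr.
Qed.

Lemma boundaries_sub_cycles X j :
  simplicial_complex X -> (boundaries X j <= cycles X j)%VS.
Proof.
case=> _ Xdown; rewrite subv_cap; apply/andP; split; last first.
  apply/subvP=> _ /memv_imgP[c _ ->]; rewrite memv_ker.
  by rewrite boundary_boundary.
rewrite /boundaries limg_span; apply/span_subvP => _ /mapP[_ /mapP[s sX ->] ->].
move: sX; rewrite mem_enum inE /simplex_dim => /andP[sX /eqP sj].
rewrite boundary_basis; apply: memv_suml => v vs; apply: memvZ.
apply: memv_span; apply/imageP; exists (s :\ v) => //.
rewrite inE (Xdown s) ?subD1set //=; apply/eqP/(addIr 1).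
by rewrite -sj (cardsD1 v s) vs PoszD /simplex_dim subrK [_%:Z + _]addrC addrK.
Qed.

Definition lambda X (l : nat) (j : int) : nat :=
  \sum_(t in faces X l) rbetti (link X t) j.

End Homology.

(* A binomial coefficient with negative upper index counts as zero; for      *)
(* l < k the product with truncated differences agrees with this convention.  *)
Definition B_const (n k l : nat) : rat :=
  ('C(n - 1, l) * 'C(n - l - 2, k - l))%:R / 'C(k.+1, l.+1)%:R.

(* Main.v *)
(** Since X contains all k-sets and every link of an (l+1)-set t contains all
    (k-l-1)-sets of [~: t], the cycle spaces in the degrees considered are those
    of full simplices, of dimension C(n-1, k) and C(n-l-2, k-l-1). A binomial
    identity then reduces the claim to an inequality between ranks of boundary
    maps,
      \sum_(t in X(l)) rank d(lk(X, t)) <= C(k+1, l+1) * rank d(X).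
    Choose a set G of k-faces of X whose boundaries form a basis of the image.
    The contraction s |-> +-(s minus t) (zero unless t \subset s) commutes with
    the boundary up to sign, so the boundaries of the g minus t, for g in G
    containing t, span the boundaries in lk(X, t). Thus the rank at t is at most
    the number of g in G containing t, and each g contains C(k+1, l+1) sets t. *)
Require Import Defs.
From mathcomp Require Import all_boot all_order all_algebra.
From mathcomp Require Import zify.
Import Order.TTheory GRing.Theory Num.Theory.
Local Open Scope ring_scope.

(** Selecting indices rather than vectors keeps track of which simplices have the chosen
    boundaries. *)
Lemma subseq_free_span (K : fieldType) (vT : vectType K) (T : eqType)
    (f : T -> vT) (s : seq T) :
  exists r : seq T, [/\ subseq r s, free (map f r) &
    <<map f r>>%VS = <<map f s>>%VS].
Proof.
elim: s => [|x s [r [rs fr rE]]]; first by exists [::]; rewrite nil_free.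
have [xr|xr] := boolP (f x \in <<map f r>>%VS).
  exists r; split=> //; first exact: subseq_trans rs (subseq_cons s x).
  by rewrite /= span_cons -rE; apply/esym/addv_idPr; rewrite -memvE.
exists (x :: r); split; first by rewrite /= eqxx.
  by rewrite /= free_cons xr.
by rewrite /= !span_cons rE.
Qed.

(** * Coordinates of chains *)

Section Chains.
Context {K : fieldType} {n : nat}.
Implicit Types (F : {set {set 'I_n}}) (s t V : {set 'I_n}) (v : 'I_n).
Local Notation chain := (chain K n).
Local Notation bc := (@basis_chain K n).
Local Notation boundary := (boundary K n).
Local Notation span_chains F := <<[seq bc s | s in F]>>%VS.
Local Notation pos s v := #|[set u in s | (u < v)%N]|.

Lemma chain_sum (c : chain) : c = \sum_s c s *: bc s.
Proof.
apply/ffunP=> t; rewrite sum_ffunE (bigD1 t) //= big1 ?addr0 => [|s st].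
  by rewrite !ffunE eqxx [_ *: _]mulr1.
by rewrite !ffunE eq_sym (negbTE st) [_ *: _]mulr0.
Qed.

Lemma mem_span_basis (r : seq {set 'I_n}) (c : chain) :
  reflect (forall s, s \notin r -> c s = 0) (c \in <<map bc r>>%VS).
Proof.
apply: (iffP idP) => [cr s sr | c0].
  rewrite (@coord_span _ _ _ (in_tuple (map bc r)) c cr) sum_ffunE big1 // => i _.
  rewrite ffunE; set x := _`_i.
  have /mapP[t tr ->] : x \in map bc r by apply/mem_nth.
  rewrite ffunE; case: eqP => [st|]; last by rewrite [_ *: _]mulr0.
  by rewrite st tr in sr.
rewrite [c]chain_sum; apply: memv_suml => s _.
have [sr|/c0->] := boolP (s \in r); last by rewrite scale0r mem0v.
by apply/memvZ/memv_span/map_f.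
Qed.

Lemma mem_span_chains F (c : chain) :
  reflect (forall s, s \notin F -> c s = 0) (c \in span_chains F).
Proof.
by apply: (iffP (mem_span_basis _ _)) => c0 s sF; apply: c0; rewrite mem_enum in sF *.
Qed.

Lemma basis_free (r : seq {set 'I_n}) : uniq r -> free (map bc r).
Proof.
elim: r => [|s r IH] /=; first by rewrite nil_free.
case/andP=> sr /IH fr; rewrite free_cons fr andbT.
apply/negP=> /mem_span_basis/(_ s sr)/eqP.
by rewrite ffunE eqxx oner_eq0.
Qed.

Lemma dim_span_chains F : \dim (span_chains F) = #|F|.
Proof.
have /eqP -> := basis_free _ (enum_uniq F).
by rewrite size_map -cardE.
Qed.

(** Contraction is specified on simplices only; this makes it a linear map. *)
Lemma basis_extension (f : {set 'I_n} -> chain) :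
  exists g : 'End(chain), forall s, g (bc s) = f s.
Proof.
pose E := enum [set: {set 'I_n}].
have [g gE] := linear_of_free (map bc E) (map f E).
exists (linfun g) => s; rewrite lfunE /=.
have := gE (basis_free _ (enum_uniq _)); rewrite !size_map => /(_ erefl).
by rewrite -map_comp => /eq_in_map gEf; apply: gEf; rewrite mem_enum inE.
Qed.

(** * Cycles of a full simplex *)

Lemma boundary_simplex_coef s t v : v \in s -> v \notin t ->
  boundary_simplex K s t = (-1) ^+ pos s v * (t == s :\ v)%:R.
Proof.
move=> vs vt; rewrite /boundary_simplex sum_ffunE (bigD1 v) //=.
rewrite big1 ?addr0 => [|u /andP[us uv]]; first by rewrite !ffunE.
rewrite !ffunE; case: eqP => [tE|]; last by rewrite [_ *: _]mulr0.
by rewrite tE !inE vs eq_sym uv in vt.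
Qed.

Lemma sign_sqr (a : nat) : (-1) ^+ a * (-1) ^+ a = 1 :> K.
Proof. by rewrite -expr2 sqrr_sign. Qed.

(* Writing [B] for the span of the simplices containing [v], the space of all
   chains is the direct sum of the cycles and [B]: modulo [B], a simplex [s]
   avoiding [v] is up to sign the boundary of [v |: s]. *)
Lemma dim_cycles_full V v (m : nat) : v \in V ->
  \dim (span_chains [set s : {set 'I_n} | s \subset V & #|s| == m]
        :&: lker boundary) = 'C(#|V|.-1, m).
Proof.
move=> vV; set F := [set s | _ & _]; set Z := (_ :&: _)%VS.
pose B := [set s in F | v \in s].
have sBF : (span_chains B <= span_chains F)%VS.
  apply/subvP=> c /mem_span_chains c0; apply/mem_span_chains=> s sF.
  by apply: c0; rewrite inE (negbTE sF).
have ZB0 : (Z :&: span_chains B = 0)%VS.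
  apply/eqP; rewrite -subv0; apply/subvP=> c; rewrite !memv_cap memv_ker.
  case/andP=> /andP[_ /eqP bc0] /mem_span_chains cB; rewrite memv0.
  apply/eqP/ffunP=> s; rewrite [RHS]ffunE.
  have [sB|/cB//] := boolP (s \in B).
  have vs : v \in s by move: sB; rewrite inE => /andP[].
  (* Among simplices containing [v], only [s] has the facet [s :\ v], so the coefficient of the
     boundary there is [c s] up to sign. *)
  move/ffunP/(_ (s :\ v)): bc0; rewrite lfunE /= /boundary_fun sum_ffunE.
  rewrite (bigD1 s) //= big1 ?addr0 => [|s' s's].
    rewrite !ffunE (@boundary_simplex_coef _ _ v) ?inE ?eqxx //= mulr1.
    move/eqP; rewrite [_ *: _ == _]mulf_eq0 => /orP[/eqP//|].
    by rewrite signr_eq0.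
  rewrite !ffunE; have [s'B|/cB->] := boolP (s' \in B); last exact: mul0r.
  have vs' : v \in s' by move: s'B; rewrite inE => /andP[].
  rewrite (@boundary_simplex_coef _ _ v) ?inE ?eqxx //.
  case: eqP => [sE|]; last by rewrite mulr0 [_ *: _]mulr0.
  by rewrite -(setD1K vs') -sE (setD1K vs) eqxx in s's.
have ZB : (Z + span_chains B)%VS = span_chains F.
  apply/eqP; rewrite eqEsubv subv_add sBF capvSl /=.
  apply/span_subvP => _ /imageP[s sF ->].
  have [vs|vs] := boolP (v \in s).
    apply/(subvP (addvSr _ _))/memv_span/imageP; exists s => //.
    by rewrite inE vs andbT.
  pose a : K := (-1) ^+ pos (v |: s) v.
  pose w := a *: boundary (bc (v |: s)).
  have wF : w \in span_chains F.
    apply: memvZ; rewrite boundary_basis; apply: memv_suml => u us.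
    apply/memvZ/memv_span/imageP; exists ((v |: s) :\ u) => //.
    move: sF; rewrite !inE => /andP[sV /eqP<-]; apply/andP; split.
      by apply: subset_trans (subsetDl _ _) _; rewrite subUset sub1set vV.
    have := cardsD1 u (v |: s); rewrite us cardsU1 vs => /eqP.
    by rewrite eqSS eq_sym.
  have -> : bc s = w + (bc s - w) by rewrite addrC subrK.
  apply: memv_add.
    by rewrite memv_cap wF memv_ker linearZ /= boundary_boundary scaler0.
  have bsF : bc s \in span_chains F by apply/memv_span/imageP; exists s.
  apply/mem_span_chains=> t tB; have [tF|tF] := boolP (t \in F); last first.
    by apply: (elimT (mem_span_chains _ _) _ t tF); rewrite rpredB.
  have vt : v \notin t by move: tB; rewrite inE tF.
  rewrite !ffunE boundary_basis (@boundary_simplex_coef _ _ v) ?setU11 //.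
  by rewrite setU1K // [_ *: _]mulrA sign_sqr mul1r subrr.
have := dimv_disjoint_sum ZB0; rewrite ZB !dim_span_chains.
(* The members of [F] outside [B] are the [m]-subsets of [V :\ v]. *)
have -> : #|F| = (#|B| + 'C(#|V|.-1, m))%N; last by rewrite addnC => /addIn.
rewrite -(cardsID [set s : {set 'I_n} | v \in s] F); congr (_ + _)%N.
  by apply: eq_card=> s; rewrite !inE.
have -> : #|V|.-1 = #|V :\ v| by rewrite (cardsD1 v V) vV.
rewrite -cards_draws; apply: eq_card => s.
by rewrite !inE subsetD1 andbCA andbA.
Qed.

(** * Contraction and ranks of boundaries in links *)

(** Interior product with [t]: up to a factor depending only on [#|t|], the sign is that of the
    shuffle moving the vertices of [t] to the front of [s]. *)
Definition contract_simplex t s : chain :=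
  if t \subset s then (-1) ^+ (\sum_(w in t) pos s w) *: bc (s :\: t) else 0.

(** Deleting a vertex of [t] gives a simplex killed by contraction. The other terms match one by
    one, and their signs agree by a parity count. *)
Lemma boundary_contract t (g : 'End(chain)) :
  (forall s, g (bc s) = contract_simplex t s) ->
  forall c, boundary (g c) = (-1) ^+ #|t| *: g (boundary c).
Proof.
move=> gE c; rewrite [c]chain_sum !linear_sum.
apply: eq_bigr => s _; rewrite !linearZ /=; congr (_ *: _).
rewrite gE boundary_basis /boundary_simplex linear_sum /= /contract_simplex.
have [ts|ts] := boolP (t \subset s); last first.
  rewrite linear0 big1 ?scaler0 // => v vs; rewrite linearZ /= gE /contract_simplex.
  rewrite subsetD1 (negbTE ts) /=; exact: scaler0.
rewrite linearZ /= boundary_basis /boundary_simplex !scaler_sumr.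
rewrite [RHS](bigID (mem t)) /= [X in _ = X + _]big1 ?add0r; last first.
  move=> v /andP[vs vt]; rewrite linearZ /= gE /contract_simplex.
  by rewrite subsetD1 vt andbF !scaler0.
apply: eq_big => [v|v]; rewrite inE ?[_ && (v \in s)]andbC // => /andP[vs vt].
rewrite [g _]linearZ /= gE /contract_simplex subsetD1 ts vt /= !scalerA.
rewrite !setDDl [t :|: _]setUC -!exprD; congr (_ *: _).
rewrite -signr_odd -[RHS]signr_odd; congr (_ ^+ (nat_of_bool _)).
(* Deleting [v] lowers by one the positions of exactly those [w] in [t] that lie above [v]. As [v]
   is not in [t], the vertices of [t] split into those below and those above [v]. *)
have sumE : \sum_(w in t) pos s w =
    (\sum_(w in t) pos (s :\ v) w + #|[set w in t | (v < w)%N]|)%N.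
  rewrite -[in RHS]sum1dep_card big_mkcondr -big_split /=.
  apply: eq_bigr => w wt; rewrite (cardsD1 v) inE vs /= addnC; congr (_ + _)%N.
    by apply: eq_card => u; rewrite !inE andbA.
have posE : pos s v = (pos (s :\: t) v + pos t v)%N.
  rewrite -(cardsID t [set u in s | (u < v)%N]) addnC; congr (_ + _)%N.
    by apply: eq_card => u; rewrite !inE andbA.
  apply: eq_card => u; rewrite !inE.
  by have [/(subsetP ts)->|] := boolP (u \in t); rewrite ?andbF ?andbT.
have tE : #|t| = (pos t v + #|[set w in t | (v < w)%N]|)%N.
  rewrite -(cardsID [set u : 'I_n | (u < v)%N] t); congr (_ + _)%N.
    by apply: eq_card => u; rewrite !inE.
  apply: eq_card => u; rewrite !inE; have [ut|] := boolP (u \in t); rewrite ?andbF //.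
  rewrite andbT /= -leqNgt leq_eqVlt val_eqE; case: eqP => // uv.
  by rewrite uv ut in vt.
have parity (a b d e : nat) : odd (d + e + a) = odd (b + e + (a + b) + d).
  by rewrite !oddD; case: (odd a); case: (odd b); case: (odd d); case: (odd e).
by rewrite sumE posE tE; apply: parity.
Qed.

(** For [F] the [k]-faces of a complex and [#|t| = l.+1], these are the faces of the link of [t] in
    dimension [k - l - 1]. *)
Definition family_link F t := [set s :\: t | s in F & t \subset s].

Lemma dim_boundary_link_le F t (r : seq {set 'I_n}) :
  <<map boundary (map bc r)>>%VS = (boundary @: span_chains F)%VS ->
  (\dim (boundary @: span_chains (family_link F t))
    <= count (fun s => t \subset s) r)%N.
Proof.
move=> rE; have [g gE] := basis_extension (contract_simplex t).
have bg := boundary_contract _ _ gE.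
rewrite -size_filter -(size_map (g \o boundary \o bc)).
apply: leq_trans (dim_span _); apply: dimvS.
have gF c : c \in (boundary @: span_chains F)%VS ->
    g c \in <<[seq (g \o boundary \o bc) s | s <- r & t \subset s]>>%VS.
  rewrite -rE => /(memv_img g); apply: subvP.
  rewrite limg_span; apply/span_subvP => _ /mapP[_ /mapP[_ /mapP[s sr ->] ->] ->].
  have [ts|ts] := boolP (t \subset s).
    by apply/memv_span/mapP; exists s; rewrite // mem_filter ts.
  (* Here [g (bc s)] is zero, so commutation up to sign forces [g] to kill [boundary (bc s)]. *)
  have := bg (bc s); rewrite gE /contract_simplex (negbTE ts) linear0.
  move/esym/eqP; rewrite scaler_eq0 signr_eq0 /= => /eqP->; exact: mem0v.
rewrite limg_span; apply/span_subvP => _ /mapP[_ /imageP[_ /imsetP[s sF ->] ->] ->].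
move: sF; rewrite inE => /andP[sF ts].
have : boundary (g (bc s)) \in
    <<[seq (g \o boundary \o bc) s | s <- r & t \subset s]>>%VS.
  rewrite bg; apply: memvZ; apply/gF/memv_img/memv_span.
  by apply/imageP; exists s.
rewrite gE /contract_simplex ts linearZ /= => /(memvZ ((-1) ^+ (\sum_(w in t) pos s w))).
by rewrite scalerA sign_sqr scale1r.
Qed.

Lemma sum_dim_boundary_link_le F p q : (forall s, s \in F -> #|s| = p) ->
  (\sum_(t : {set 'I_n} | #|t| == q)
     \dim (boundary @: span_chains (family_link F t))
   <= 'C(p, q) * \dim (boundary @: span_chains F))%N.
Proof.
move=> Fp.
have [r [rF fr rE]] := subseq_free_span K chain _ (boundary \o bc) (enum F).
have {}rE : <<map boundary (map bc r)>>%VS = (boundary @: span_chains F)%VS.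
  by rewrite limg_span -!map_comp.
apply: (@leq_trans (\sum_(t : {set 'I_n} | #|t| == q) \sum_(s <- r | t \subset s) 1)).
  by apply: leq_sum => t _; rewrite sum1_count; apply: dim_boundary_link_le.
(* Double counting of pairs [t \subset s]: freeness makes the size of [r] equal to the rank, and
   each [s] in [r] has ['C(p, q)] subsets of size [q]. *)
rewrite (exchange_big_dep xpredT) //= -rE -map_comp (eqP fr) size_map mulnC.
rewrite -sum1_size big_distrl /= [X in (X <= _)%N]big_seq [X in (_ <= X)%N]big_seq.
apply: leq_sum => s /(mem_subseq rF); rewrite mem_enum => /Fp <-.
rewrite mul1n sum1dep_card -cards_draws subset_leq_card //.
by apply/subsetP => t; rewrite !inE andbC.
Qed.

End Chains.

(** * Binomial identities *)

Lemma bin_mul_bin n k l : (l <= k)%N -> (k <= n)%N ->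
  ('C(n, k) * 'C(k, l) = 'C(n, l) * 'C(n - l, k - l))%N.
Proof.
move=> lk kn; have ln := leq_trans lk kn.
have kln : (k - l <= n - l)%N by lia.
have := bin_fact kln; have -> : (n - l - (k - l) = n - k)%N by lia.
have := bin_fact kn; have := bin_fact lk; have := bin_fact ln.
have := fact_gt0 l; have := fact_gt0 (k - l); have := fact_gt0 (n - k).
move: 'C(_, _) 'C(_, _) 'C(_, _) 'C(_, _) => a b c d z0 y0 x0 aE bE cE dE.
apply/eqP; rewrite -(eqn_pmul2r (_ : 0 < l`! * (k - l)`! * (n - k)`!)%N).
  by rewrite ?muln_gt0 ?x0 ?y0 ?z0; apply/eqP; nia.
by rewrite !muln_gt0 x0 y0 z0.
Qed.

(** Pascal's rule splits ['C(k.+1, l.+1)]; each product with ['C(n.-1, k)] is then rewritten by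
    [bin_mul_bin], and Pascal's rule regroups the result. *)
Lemma bin_link_identity n k l : (l < k)%N -> (k < n)%N ->
  ('C(k.+1, l.+1) * 'C(n.-1, k) =
   'C(n, l.+1) * 'C(n - l - 2, k - l - 1) + 'C(n - 1, l) * 'C(n - l - 2, k - l))%N.
Proof.
case: n => // n lk kn; rewrite subn1 /= !binS !mulnDl ![(_ * 'C(n, k))%N]mulnC.
rewrite (bin_mul_bin _ _ _ lk) // (bin_mul_bin _ _ _ (ltnW lk)) //.
have -> : (n.+1 - l - 2 = n - l.+1)%N by lia.
have -> : (n - l = (n - l.+1).+1)%N by lia.
have -> : (k - l = (k - l.+1).+1)%N by lia.
rewrite binS subn1 /=; lia.
Qed.

(** * From ranks to Betti numbers *)

Lemma mem_faces n (X : {set {set 'I_n}}) (m : nat) s :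
  (s \in faces X (m%:Z - 1)) = (s \in X) && (#|s| == m).
Proof. by rewrite inE /simplex_dim (inj_eq (addIr _)) eqz_nat. Qed.

Theorem theorem2 (K : fieldType) (n k l : nat) (X : {set {set 'I_n}})
  (hX : simplicial_complex X)
  (hskel : skeleton (full_simplex n) (k%:Z - 1) \subset X)
  (hXn : X \subset full_simplex n)
  (hlk : (l < k)%N) :
  (rbetti K X (k%:Z - 1))%:R <=
    1 / 'C(k.+1, l.+1)%:R * (lambda K X l (k%:Z - l%:Z - 2))%:R
    + B_const n k l :> rat.
Proof.
have b_gt0 : (0 < 'C(k.+1, l.+1))%N by rewrite bin_gt0; lia.
suff main : ('C(k.+1, l.+1) * rbetti K X (k%:Z - 1) <=
    lambda K X l (k%:Z - l%:Z - 2) + 'C(n - 1, l) * 'C(n - l - 2, k - l))%N.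
  rewrite /B_const mul1r [_^-1 * _]mulrC -mulrDl ler_pdivlMr ?ltr0n //.
  by rewrite -natrD -natrM ler_nat mulnC.
have Xk (s : {set 'I_n}) : (#|s| <= k)%N -> s \in X.
  move=> sk; apply: (subsetP hskel); by rewrite !inE /simplex_dim lerD2r lez_nat.
(* Cycles in a given degree depend only on the faces of that degree, so [Y] may be compared with the
   full simplex on [V]. *)
have cyclesE (Y : {set {set 'I_n}}) (V : {set 'I_n}) (m : nat) v : v \in V ->
    (forall s : {set 'I_n}, (s \in Y) && (#|s| == m) = (s \subset V) && (#|s| == m)) ->
    \dim (cycles K Y (m%:Z - 1)) = 'C(#|V|.-1, m).
  move=> vV YE.
  have E : faces Y (m%:Z - 1) = [set s : {set 'I_n} | s \subset V & #|s| == m].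
    by apply/setP=> s; rewrite mem_faces inE YE.
  by rewrite /cycles /chains E (dim_cycles_full _ v).
have zk : (0 < n)%N -> \dim (cycles K X (k%:Z - 1)) = 'C(n.-1, k).
  move=> n0; rewrite (cyclesE X [set: 'I_n] k (Ordinal n0)) ?cardsT ?card_ord ?inE //.
  by move=> s; rewrite subsetT; have [sk|] := eqP; rewrite ?andbF ?andbT // Xk ?sk.
(* With at most [k] vertices the Betti number vanishes. The case [n = 0] is separate because
   [cyclesE] asks for a vertex. *)
have [nk|kn] := leqP n k.
  suff -> : rbetti K X (k%:Z - 1) = 0%N by rewrite muln0.
  apply/eqP; rewrite /rbetti -leqn0 leq_subLR addn0; apply: leq_trans (leq0n _).
  have [n0|n0] := posnP n; last by rewrite zk // bin_small //; lia.
  apply: leq_trans (dimvS (capvSl _ _)) _; rewrite dim_span_chains leqn0 cards_eq0.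
  apply/eqP/setP=> s; rewrite mem_faces inE; apply/negP=> /andP[_ /eqP sk].
  have : (#|s| <= #|'I_n|)%N by apply: max_card.
  by rewrite sk card_ord; lia.
pose F := faces X k; pose r := \dim (boundary K n @: <<[seq basis_chain K s | s in F]>>).
(* An equality, since boundaries are cycles and the subtraction in [rbetti] does not truncate. *)
have betti_rank : (rbetti K X (k%:Z - 1) + r = 'C(n.-1, k))%N.
  have := dimvS (boundaries_sub_cycles K (k%:Z - 1) hX).
  by rewrite /rbetti zk ?(leq_ltn_trans _ kn) // /boundaries subrK => /subnK.
pose rt t := \dim (boundary K n @: <<[seq basis_chain K s | s in family_link F t]>>).
have FE s : s \in F -> #|s| = k.+1.
  by rewrite inE /simplex_dim => /andP[_ /eqP]; lia.
have link_rank (t : {set 'I_n}) : #|t| = l.+1 ->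
    ('C(n - l - 2, k - l - 1) <= rbetti K (link X t) (k%:Z - l%:Z - 2) + rt t)%N.
  move=> tl.
  have -> : k%:Z - l%:Z - 2 = (k - l - 1)%N%:Z - 1 by lia.
  have Vc : #|~: t| = (n - l.+1)%N by rewrite cardsCs setCK card_ord tl.
  have /card_gt0P[v vV] : (0 < #|~: t|)%N by rewrite Vc; lia.
  have -> : 'C(n - l - 2, k - l - 1) = \dim (cycles K (link X t) ((k - l - 1)%N%:Z - 1)).
    rewrite (cyclesE _ _ _ _ vV) ?Vc; first by congr 'C(_, _); lia.
    move=> s; rewrite inE setI_eq0 disjoints_subset.
    have [sm|] := eqVneq #|s| (k - l - 1)%N; last by rewrite !andbF.
    have sX : s \in X by rewrite Xk // sm; lia.
    (* The union has at most [(k - l - 1) + (l + 1) = k] vertices. *)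
    have stX : s :|: t \in X.
      by apply: Xk; have := cardsUI s t; rewrite sm tl; lia.
    by rewrite sX stX.
  suff : (\dim (boundaries K (link X t) ((k - l - 1)%N%:Z - 1)) <= rt t)%N.
    by rewrite /rbetti; lia.
  apply/dimvS/limgS/sub_span => _ /imageP[s sL ->]; apply/imageP; exists s => //.
  move: sL; rewrite !inE /simplex_dim setI_eq0 => /andP[/and3P[_ stX sdt] sm].
  apply/imsetP; exists (s :|: t).
    rewrite !inE stX subsetUr /simplex_dim andbT /=.
    move/eqP: sm => sm; apply/eqP; have := cardsUI s t.
    rewrite (disjoint_setI0 sdt) cards0 tl.
    by move: sm; move: #|s| #|s :|: t| => a b; lia.
  by rewrite setDUl setDv setU0; apply/esym/setDidPl.
have facesl (t : {set 'I_n}) : (t \in faces X l) = (#|t| == l.+1).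
  rewrite inE /simplex_dim; have [tl|tl] := eqVneq #|t| l.+1.
    by rewrite Xk ?tl //; lia.
  by rewrite andbC; case: eqP => //; lia.
have lambda_ge : ('C(n, l.+1) * 'C(n - l - 2, k - l - 1) <=
    lambda K X l (k%:Z - l%:Z - 2) + \sum_(t : {set 'I_n} | #|t| == l.+1) rt t)%N.
  rewrite /lambda (eq_bigl _ _ facesl) -big_split /=.
  have <- : #|[set t : {set 'I_n} | #|t| == l.+1]| = 'C(n, l.+1).
    by rewrite card_draws card_ord.
  rewrite -sum_nat_const; under eq_bigl do rewrite inE.
  by apply: leq_sum => t /eqP; apply: link_rank.
have rank_le : (\sum_(t : {set 'I_n} | #|t| == l.+1) rt t <= 'C(k.+1, l.+1) * r)%N.
  exact: sum_dim_boundary_link_le.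
(* Adding ['C(k.+1, l.+1) * r] to both sides turns the left side into the binomial identity;
   [rank_le] absorbs the same term on the right. *)
have := bin_link_identity _ _ _ hlk kn; rewrite -betti_rank mulnDr => id_eq.
rewrite -(leq_add2r ('C(k.+1, l.+1) * r)) id_eq [X in (_ <= X)%N]addnAC leq_add2r.
exact: leq_trans lambda_ge (leq_add (leqnn _) rank_le).
Qed.
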